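(* Let $u_n$ be the number of $DU_k$-equivalence classes of the set $\mathcal{L}_n$ of Łukasiewicz paths of length $n$. Then $$\sum_{n\geq0}u_nx^n=\frac{1-x-x^2-2x^3+\sqrt{1-2x-x^2-2x^3+x^4}}{1-2x-x^3+(1-x)\sqrt{1-2x-x^2-2x^3+x^4}},$$ and $u_0=u_1=u_2=1$ and $u_n=a_{n-1}$ for $n\geq 3$, where $a_0=1$ and $a_{m+1}=a_m+\sum_{k=1}^{m-1}a_ka_{m-1-k}$ for $m\geq0$.
   Context: A Łukasiewicz path of length $n$ is a sequence of $n$ steps from $\{(1,i): i\geq -1\}$ starting at $(0,0)$, ending at $(n,0)$ and never going below the $x$-axis. Write $D=(1,-1)$, $F=(1,0)$, $U_k=(1,k)$ for $k\geq1$. Steps are numbered $1,\dots,n$; an occurrence of $DU_k$ is at position $i$ if its $D$ is the $i$-th step. Two Łukasiewicz paths of the same length are $DU_k$-equivalent if for every $k\geq1$ the set of occurrence positions of $DU_k$ is the same in both. *)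

(* Defs.v *)
From HB Require Import structures.
From mathcomp Require Import all_boot all_order all_algebra.
From mathcomp Require Import finmap all_classical.
Set Implicit Arguments.
Unset Strict Implicit.
Unset Printing Implicit Defensive.
Import Order.TTheory GRing.Theory Num.Theory.
Local Open Scope ring_scope.

(* A record rather than a bare function type: functions into a ring already
   carry the pointwise product. *)
Record fps (F : fieldType) := Fps { coefs :> nat -> F }.

HB.instance Definition _ (F : fieldType) := gen_eqMixin (fps F).
HB.instance Definition _ (F : fieldType) := gen_choiceMixin (fps F).

Lemma fpsP (F : fieldType) (f g : fps F) : f =1 g -> f = g.
Proof. by case: f g => [f] [g] /= /funext ->. Qed.

(* Definition by course-of-values recursion: the n-th coefficient is computed
   from the list of the n previous ones. *)
Section CourseOfValues.
Variables (F : fieldType) (next : seq F -> F).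

Fixpoint cov_seq n : seq F :=
  if n is m.+1 then rcons (cov_seq m) (next (cov_seq m)) else [::].

Definition cov : fps F := Fps (fun n => next (cov_seq n)).

Lemma cov_seqE n : cov_seq n = mkseq cov n.
Proof. by elim: n => //= n IHn; rewrite mkseqS -IHn. Qed.

Lemma covE n : cov n = next (mkseq cov n).
Proof. by rewrite -cov_seqE. Qed.

End CourseOfValues.

Section FpsRing.
Variable F : fieldType.
Implicit Types f g h : fps F.

Definition fps_zero : fps F := Fps (fun=> 0).
Definition fps_one : fps F := Fps (fun n => (n == 0)%:R).
Definition fps_opp f : fps F := Fps (fun n => - f n).
Definition fps_add f g : fps F := Fps (fun n => f n + g n).
Definition fps_mul f g : fps F :=
  Fps (fun n => \sum_(j < n.+1) f j * g (n - j)%N).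

Fact fps_addA : associative fps_add.
Proof. by move=> f g h; apply: fpsP => n /=; rewrite addrA. Qed.
Fact fps_addC : commutative fps_add.
Proof. by move=> f g; apply: fpsP => n /=; rewrite addrC. Qed.
Fact fps_add0 : left_id fps_zero fps_add.
Proof. by move=> f; apply: fpsP => n /=; rewrite add0r. Qed.
Fact fps_addN : left_inverse fps_zero fps_opp fps_add.
Proof. by move=> f; apply: fpsP => n /=; rewrite addNr. Qed.

HB.instance Definition _ :=
  GRing.isZmodule.Build (fps F) fps_addA fps_addC fps_add0 fps_addN.

Let tr n f : {poly F} := \poly_(i < n.+1) f i.

Let coef_tr n f i : (i <= n)%N -> (tr n f)`_i = f i.
Proof. by move=> le_in; rewrite coef_poly ltnS le_in. Qed.

Let mul_tr n f g i : (i <= n)%N -> fps_mul f g i = (tr n f * tr n g)`_i.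
Proof.
move=> le_in; rewrite coefM; apply: eq_bigr => j _.
have le_ji : (j <= i)%N by rewrite -ltnS.
by rewrite !coef_tr ?(leq_trans _ le_in) ?leq_subr.
Qed.

Fact fps_mulC : commutative fps_mul.
Proof. by move=> f g; apply: fpsP => n; rewrite !(@mul_tr n) // mulrC. Qed.

Fact fps_mulA : associative fps_mul.
Proof.
move=> f g h; apply: fpsP => n.
have {1}-> : fps_mul f (fps_mul g h) n = (tr n f * (tr n g * tr n h))`_n.
  rewrite coefM; apply: eq_bigr => j _.
  by rewrite coef_tr ?leq_ord // (@mul_tr n) ?leq_subr.
have -> : fps_mul (fps_mul f g) h n = (tr n f * tr n g * tr n h)`_n.
  rewrite coefM; apply: eq_bigr => j _.
  by rewrite coef_tr ?leq_subr // (@mul_tr n) ?leq_ord.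
by rewrite mulrA.
Qed.

Fact fps_mul1 : left_id fps_one fps_mul.
Proof.
move=> f; apply: fpsP => n /=.
by rewrite big_ord_recl subn0 mul1r big1 ?addr0 // => i _; rewrite mul0r.
Qed.

Fact fps_mulDl : left_distributive fps_mul fps_add.
Proof.
move=> f g h; apply: fpsP => n /=; rewrite -big_split /=.
by apply: eq_bigr => i _; rewrite mulrDl.
Qed.

Fact fps_oner_neq0 : fps_one != fps_zero.
Proof.
by apply/eqP => /(congr1 (fun f : fps F => f 0%N))/eqP; rewrite /= oner_eq0.
Qed.

HB.instance Definition _ := GRing.Zmodule_isComNzRing.Build (fps F)
  fps_mulA fps_mulC fps_mul1 fps_mulDl fps_oner_neq0.

Lemma fps0E n : (0 : fps F) n = 0. Proof. by []. Qed.
Lemma fps1E n : (1 : fps F) n = (n == 0)%:R. Proof. by []. Qed.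
Lemma fpsDE f g n : (f + g) n = f n + g n. Proof. by []. Qed.
Lemma fpsNE f n : (- f) n = - f n. Proof. by []. Qed.
Lemma fpsME f g n : (f * g) n = \sum_(j < n.+1) f j * g (n - j)%N.
Proof. by []. Qed.

Definition fpsX : fps F := Fps (fun n => (n == 1)%:R).

(* The series with nonzero constant term are the invertible ones; as usual for
   unit rings, the inverse of any other series is set to be itself. *)
Definition fps_unit : pred (fps F) := fun f => f 0%N != 0.

Definition fps_inv_next f (s : seq F) : F :=
  if size s == 0 then (f 0%N)^-1
  else - (f 0%N)^-1 * \sum_(i < size s) s`_i * f (size s - i)%N.

Definition fps_inv f : fps F :=
  if fps_unit f then cov (fps_inv_next f) else f.

Fact fps_mulV : {in fps_unit, left_inverse 1 fps_inv *%R}.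
Proof.
move=> f uf; have f0 : f 0%N != 0 := uf.
rewrite /fps_inv (_ : fps_unit f = true) //; apply: fpsP => n.
have := covE (fps_inv_next f) n; set g := cov _ => gn.
rewrite fpsME fps1E big_ord_recr subnn [X in _ = X]/= {}gn /=.
rewrite /fps_inv_next size_mkseq.
case: eqP => [->|_]; first by rewrite big_ord0 add0r mulVf.
rewrite mulrAC mulNr mulVf // mulN1r; apply/eqP; rewrite subr_eq0; apply/eqP.
by apply: eq_bigr => i _; rewrite nth_mkseq.
Qed.

Fact fps_unitP f g : g * f = 1 -> fps_unit f.
Proof.
move=> /(congr1 (fun h : fps F => h 0%N)); rewrite fpsME big_ord1 fps1E => e.
by apply/eqP => f0; move/eqP: e; rewrite f0 mulr0 eq_sym oner_eq0.
Qed.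

Fact fps_invr_out : {in [predC fps_unit], fps_inv =1 id}.
Proof. by move=> f nuf; rewrite /fps_inv (negbTE (nuf : ~~ fps_unit f)). Qed.

HB.instance Definition _ := GRing.ComNzRing_hasMulInverse.Build (fps F)
  fps_mulV fps_unitP fps_invr_out.

(* The square root with constant term 1 of a series with constant term 1:
   2 s_n = f_n - \sum_(1 <= i < n) s_i s_{n-i} for n > 0. *)
Definition fps_sqrt_next f (s : seq F) : F :=
  if size s == 0 then 1
  else (f (size s) - \sum_(1 <= i < size s) s`_i * s`_(size s - i)) / 2.

Definition fps_sqrt f : fps F := cov (fps_sqrt_next f).

Lemma fps_sqrt0 f : fps_sqrt f 0%N = 1.
Proof. by rewrite /fps_sqrt covE. Qed.

Lemma sqr_fps_sqrt f : (2 : F) != 0 -> f 0%N = 1 -> fps_sqrt f ^+ 2 = f.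
Proof.
move=> two0 f0; apply: fpsP => -[|n].
  by rewrite expr2 fpsME big_ord1 fps_sqrt0 mul1r f0.
rewrite expr2 fpsME big_ord_recr big_ord_recl subn0 subnn fps_sqrt0 mul1r mulr1.
have := covE (fps_sqrt_next f) n.+1; rewrite -/(fps_sqrt f) => ->.
rewrite /fps_sqrt_next size_mkseq big_add1 big_mkord.
set S := \sum_(i < n) _.
set T := \sum_(i < n) _; have -> : S = T.
  apply: eq_bigr => i _.
  by rewrite !nth_mkseq ?subSS ?ltnS ?(leq_trans (leq_subr _ _)).
by rewrite /= addrAC -mulrDl -mulr2n -[(_ - _) *+ 2]mulr_natr mulfK // subrK.
Qed.

End FpsRing.

(* A path is the list of the ordinates i of its steps (1, i), so that D is -1,
   F is 0 and U_k is k; the ordinate after m steps is the sum of the first m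
   entries. *)
Definition lukasiewicz (n : nat) : set (seq int) :=
  [set p : seq int |
    [/\ size p = n,
        (forall i : int, i \in p -> -1 <= i),
        (forall m : nat, (m <= n)%N -> 0 <= \sum_(i <- take m p) i)
      & \sum_(i <- p) i = 0]].

(* Steps are numbered from 1 whereas [nth] counts from 0. *)
Definition DU_positions (k : nat) (p : seq int) : set nat :=
  [set i | [/\ (0 < i < size p)%N, nth 0 p i.-1 = -1 & nth 0 p i = k%:Z]].

Definition DU_equiv (p q : seq int) : Prop :=
  forall k, (1 <= k)%N -> DU_positions k p = DU_positions k q.

Definition DU_class (n : nat) (p : seq int) : set (seq int) :=
  [set q | lukasiewicz n q /\ DU_equiv p q].

Definition DU_classes (n : nat) : set (set (seq int)) :=
  [set DU_class n p | p in lukasiewicz n].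

(* [fset_set] is only meaningful on finite sets; see [finite_DU_classes]. *)
Definition num_DU_classes (n : nat) : nat := #|` fset_set (DU_classes n)|%fset.

Lemma finite_lukasiewicz n : finite_set (lukasiewicz n).
Proof.
pose path_of (t : n.-tuple 'I_n.+1) := [seq (nat_of_ord i)%:Z - 1 | i <- t].
apply: (@sub_finite_set _ _ [set path_of t | t in [set: n.-tuple 'I_n.+1]]);
  last exact/finite_image/finite_finset.
move=> p [sz ge sum_ge sum0] /=.
have sumD : \sum_(i <- p) (i + 1) = n%:Z.
  by rewrite big_split /= sum0 add0r big_const_seq count_predT sz iter_addr_0 natz.
have le_n i : i \in p -> i + 1 <= n%:Z.
  move=> ip; rewrite -sumD (big_rem i) //= lerDl big_seq sumr_ge0 // => j.
  by move=> /mem_rem /ge; rewrite -lerBlDr sub0r.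
have sz' : size [seq (inord (absz (i + 1)) : 'I_n.+1) | i <- p] == n by rewrite size_map sz.
exists (Tuple sz' : n.-tuple 'I_n.+1) => //.
rewrite /path_of /= -map_comp -[RHS]map_id; apply/eq_in_map => i ip /=.
have i1 : 0 <= i + 1 by rewrite -lerBlDr sub0r ge.
rewrite inordK; first by rewrite gez0_abs // addrK.
by rewrite ltnS -lez_nat gez0_abs // le_n.
Qed.

Lemma finite_DU_classes n : finite_set (DU_classes n).
Proof. exact/finite_image/finite_lukasiewicz. Qed.

(* Main.v *)
(* Keeping the letters U_k that follow a D and replacing every other letter by D
   turns a path p into a complete invariant w(p) of its class.  Lowering steps
   can only make the suffix sums smaller, so w(p) = D q where all suffix sums
   of q are nonpositive; conversely, raising the first letter of such a D q to
   the value that makes the total zero gives a path with invariant D q.  Hence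
   u_(n+1) counts the words q of length n over D and the U_k, with nonpositive
   suffix sums, in which every U_k follows a D.  Such a q, if longer than one
   letter, is D q' or D U_k q'' with 1 <= k <= depth q'', where the depth is
   minus the total; and choosing a level between 1 and the depth of q amounts to
   splitting q = q1 q2 with q2 nonempty into two such words, the level being the
   depth of q2.  This gives the recurrence, so the generating function A of these
   words satisfies A = 1 + xA + x^2 (A - 1) A, and the square root in the
   statement is 1 - x + x^2 - 2 x^2 A. *)

Require Import Defs.
From mathcomp Require Import all_boot all_order all_algebra.
From mathcomp Require Import finmap all_classical zify ring.
Import Order.TTheory GRing.Theory Num.Theory.
Local Open Scope ring_scope.
Set Implicit Arguments.
Unset Strict Implicit.
Unset Printing Implicit Defensive.

(** * Words with nonpositive suffix sums *)

Definition total (q : seq int) : int := \sum_(i <- q) i.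

Lemma total_nil : total [::] = 0.
Proof. exact: big_nil. Qed.

Lemma total_cons i q : total (i :: q) = i + total q.
Proof. exact: big_cons. Qed.

Lemma total_take_drop m q : total q = total (take m q) + total (drop m q).
Proof. by rewrite -{1}(cat_take_drop m q) /total big_cat. Qed.

(* Used on words of nonpositive total, so that it is minus the total. *)
Definition depth (q : seq int) : nat := absz (total q).

(* The words q of the header; in the last list k + 1 is the depth of the new
   word. *)
Fixpoint tails (n : nat) : seq (seq int) :=
  match n with
  | 0 => [:: [::]]
  | 1 => [:: [:: -1]]
  | (m.+1 as m').+1 =>
      [seq -1 :: q | q <- tails m'] ++
      [seq [:: -1, (depth q - k)%N%:Z & q] | q <- tails m, k <- iota 0 (depth q)]
  end.

Lemma tailsSS n : tails n.+2 =
  [seq -1 :: q | q <- tails n.+1] ++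
  [seq [:: -1, (depth q - k)%N%:Z & q] | q <- tails n, k <- iota 0 (depth q)].
Proof. by []. Qed.

(** The one-letter word falls under the second case, and the letter [depth q - k] of [tails] runs
    through 1, ..., [depth q]. *)
Lemma tails_ind (P : nat -> seq int -> Prop) :
  P 0%N [::] ->
  (forall n q, q \in tails n -> P n q -> P n.+1 (-1 :: q)) ->
  (forall n q k, q \in tails n -> P n q -> (0 < k <= depth q)%N ->
     P n.+2 [:: -1, k%:Z & q]) ->
  forall n q, q \in tails n -> P n q.
Proof.
move=> P0 P1 P2 n.
have [m le_nm] := ubnP n; elim: m n le_nm => // m IH [|[|n]] le_nm q.
- by rewrite inE => /eqP ->.
- by rewrite inE => /eqP ->; apply: P1; [rewrite inE | apply: IH; rewrite ?inE].
rewrite tailsSS mem_cat => /orP[/mapP[q' q'T ->]|/allpairsPdep[q' [k [q'T]]]].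
  by apply: P1 => //; apply: IH.
rewrite mem_iota => /= kq ->; apply: P2 => //; last by lia.
by apply: IH => //; lia.
Qed.

Lemma size_tails n (q : seq int) : q \in tails n -> size q = n.
Proof. by move: n q; apply: tails_ind => //= [n q _ ->|n q k _ ->]. Qed.

Lemma tails_ge n (q : seq int) : q \in tails n -> {in q, forall i, -1 <= i}.
Proof.
move: n q; apply: tails_ind => //= [n q _ IH i|n q k _ IH _ i].
  by rewrite inE => /orP[/eqP ->|/IH].
by rewrite !inE => /or3P[/eqP ->|/eqP ->|/IH].
Qed.

Lemma sum_drop_tails n (q : seq int) m : q \in tails n -> total (drop m q) <= 0.
Proof.
move=> qT; move: n q qT m; apply: tails_ind.
- by move=> m; rewrite total_nil.
- move=> n q _ IH [|m] /=; last exact: IH.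
  by rewrite total_cons; have := IH 0%N; rewrite drop0; lia.
- move=> n q k _ IH; rewrite /depth => kq m.
  have := IH 0%N; rewrite drop0 => q0.
  by case: m => [|[|m]] /=; rewrite ?total_cons; try lia; apply: IH.
Qed.

Lemma sum_tails n (q : seq int) : q \in tails n -> total q = - (depth q)%:Z.
Proof. by move=> /(sum_drop_tails 0); rewrite drop0 /depth; lia. Qed.

Lemma depth_cons n (q : seq int) : q \in tails n -> depth (-1 :: q) = (depth q).+1.
Proof. by move=> /sum_tails; rewrite /depth total_cons; lia. Qed.

Lemma depth_cons2 n (q : seq int) k : q \in tails n -> (k < depth q)%N ->
  depth [:: -1, (depth q - k)%N%:Z & q] = k.+1.
Proof. by move=> /sum_tails; rewrite /depth !total_cons; lia. Qed.

(** The default -1 covers the empty word. *)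
Lemma nth0_tails n (q : seq int) : q \in tails n -> nth (-1) q 0 = -1.
Proof. by move: n q; apply: tails_ind. Qed.

Lemma uniq_tails n : uniq (tails n).
Proof.
have [m le_nm] := ubnP n; elim: m n le_nm => // m IH [|[|n]] // le_nm.
rewrite tailsSS cat_uniq; apply/and3P; split.
- by rewrite map_inj_uniq => [|q q' []] //; apply: IH.
(* In a common word the second letter would be both positive and -1. *)
- apply/hasPn => w /allpairsPdep[q [k [qT]]]; rewrite mem_iota => kq ->.
  apply/negP => /mapP[q' /nth0_tails + [eq_q']].
  by rewrite -eq_q' /=; lia.
apply: allpairs_uniq_dep => [|q _|]; [apply: IH; lia | exact: iota_uniq |].
move=> _ _ /allpairsPdep[q [k [_ + ->]]] /allpairsPdep[q' [k' [_ + ->]]] /=.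
rewrite !mem_iota => kq k'q' [eq_k eq_q]; rewrite -eq_q in k'q' eq_k *.
by congr existT; lia.
Qed.

(** * Sums over words of functions of the depth *)

Definition weight n (phi : nat -> nat) : nat := (\sum_(q <- tails n) phi (depth q))%N.

Lemma eq_weight n phi psi : phi =1 psi -> weight n phi = weight n psi.
Proof. by move=> e; apply: eq_bigr => q _. Qed.

Lemma weightD n phi psi :
  weight n (fun h => (phi h + psi h)%N) = (weight n phi + weight n psi)%N.
Proof. by rewrite /weight big_split. Qed.

Lemma weightM n c phi : weight n (fun h => (c * phi h)%N) = (c * weight n phi)%N.
Proof. by rewrite /weight big_distrr. Qed.

Lemma weight1 n : weight n (fun=> 1%N) = size (tails n).
Proof. by rewrite /weight sum1_size. Qed.

Lemma weight_0 phi : weight 0 phi = phi 0%N.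
Proof. by rewrite /weight big_seq1 /depth total_nil. Qed.

Lemma weight_1 phi : weight 1 phi = phi 1%N.
Proof. by rewrite /weight big_seq1 /depth total_cons total_nil. Qed.

(** Prefixing D raises the depth by one; prefixing some D U_k gives each depth from 1 to the old one
    exactly once. *)
Lemma weightSS n phi : weight n.+2 phi =
  (weight n.+1 (phi \o succn) + weight n (fun h => \sum_(k < h) phi k.+1))%N.
Proof.
rewrite /weight tailsSS big_cat big_map big_allpairs_dep; congr (_ + _)%N.
  by apply: eq_big_seq => q qT; rewrite (depth_cons qT).
apply: eq_big_seq => q qT.
rewrite -[X in iota 0 X]subn0 -/(index_iota _ _) big_mkord.
by apply: eq_bigr => k _; rewrite (depth_cons2 qT).
Qed.

Lemma size_tailsSS n :
  size (tails n.+2) = (size (tails n.+1) + weight n id)%N.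
Proof.
rewrite -!weight1 weightSS; congr (_ + _)%N.
by apply: eq_weight => h; rewrite sum1_card card_ord.
Qed.

(* The weight on the left counts pairs of a word q and a level k <= depth q;
   cutting q at its crossing of level k leaves a suffix of depth k, weighted by
   phi, and an arbitrary word. *)
Lemma weight_convolution n (phi : nat -> nat) :
  weight n (fun h => (\sum_(k < h.+1) phi k)%N) =
  (\sum_(i < n.+1) weight i phi * size (tails (n - i)))%N.
Proof.
have [m le_nm] := ubnP n; elim: m n le_nm phi => // m IH [|[|n]] le_nm phi.
- by rewrite weight_0 !big_ord1 weight_0 /= muln1.
- by rewrite weight_1 !big_ord_recl !big_ord0 weight_0 weight_1 /= !muln1.
(* Splitting off [phi 0] turns both halves of [weightSS] into sums of the same shape, for
   [phi \o succn] and [phi1]; hence the induction over all [phi]. *)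
pose phi1 (h : nat) := (\sum_(k < h) phi k.+1)%N.
have sumS h : (\sum_(k < h.+1) phi k = phi 0%N + phi1 h)%N.
  by rewrite big_ord_recl.
rewrite weightSS (@eq_weight n.+1 _
  (fun h => phi 0 * 1 + \sum_(k < h.+1) (phi \o succn) k)%N); last first.
  by move=> h /=; rewrite sumS muln1.
rewrite (@eq_weight n _
  (fun h => phi 0 * h + \sum_(k < h.+1) phi1 k)%N); last first.
  move=> h; rewrite (eq_bigr (fun k : 'I_h => phi 0 + phi1 k.+1)%N) //.
  rewrite big_split /= sum_nat_const card_ord mulnC; congr (_ + _)%N.
  by rewrite [RHS]big_ord_recl /phi1 big_ord0 add0n.
rewrite !weightD !weightM !IH ?weight1; try lia.
have -> : (\sum_(i < n.+2) weight i (phi \o succn) * size (tails (n.+1 - i)) =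
    phi 1 * size (tails n.+1) +
    \sum_(i < n.+1) weight i.+1 (phi \o succn) * size (tails (n - i)))%N.
  by rewrite big_ord_recl weight_0.
have -> : (\sum_(i < n.+3) weight i phi * size (tails (n.+2 - i)) =
    phi 0 * size (tails n.+2) + (phi 1 * size (tails n.+1) +
    (\sum_(i < n.+1) weight i.+1 (phi \o succn) * size (tails (n - i)) +
     \sum_(i < n.+1) weight i phi1 * size (tails (n - i)))))%N.
  rewrite 2!big_ord_recl weight_0 weight_1 -big_split /=.
  congr (_ + (_ + _))%N; apply: eq_bigr => i _.
  by rewrite -mulnDl -weightSS.
by rewrite size_tailsSS; ring.
Qed.

(** A nonempty word is D followed by a word of nonpositive total. *)
Lemma weight_gt0 n : weight n.+1 (fun h => (0 < h)%N) = size (tails n.+1).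
Proof.
rewrite -weight1; apply: eq_big_seq => q; case: q => [/size_tails //|j q qT].
have := nth0_tails qT; rewrite /= => j1.
have := sum_drop_tails 1 qT; rewrite /= drop0 /depth total_cons j1 => s.
by apply/eqP; rewrite eqb1; lia.
Qed.

(** A depth h is the number of levels k <= h with 0 < k, so [weight_convolution] applies to that
    indicator; its term for the empty word vanishes. *)
Lemma size_tailsS m : size (tails m.+1) =
  (size (tails m) +
   \sum_(1 <= k < m) size (tails k) * size (tails (m - 1 - k)))%N.
Proof.
case: m => [|m]; first by rewrite big_geq.
rewrite size_tailsSS (@eq_weight _ _ (fun h => \sum_(k < h.+1) (0 < k))%N); last first.
  by move=> h; rewrite big_ord_recl add0n sum1_card card_ord.
rewrite (weight_convolution _ (fun k => 0 < k)%N) big_ord_recl weight_0 mul0n add0n.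
rewrite big_add1 big_mkord subn1 /=; congr (_ + _)%N.
by apply: eq_bigr => i _; rewrite weight_gt0.
Qed.

(** * The invariant of a path *)

Definition DU_step (i j : int) : int := if (i == -1) && (1 <= j) then j else -1.

(** The dummy letter 0 in front is not a D, so the first letter always becomes -1. *)
Definition DU_word (p : seq int) : seq int := pairmap DU_step 0 p.

Lemma DU_stepP i j (k : nat) : (1 <= k)%N ->
  DU_step i j = k%:Z <-> i = -1 /\ j = k%:Z.
Proof.
move=> k1; rewrite /DU_step; split; last by case=> -> ->; rewrite eqxx lez_nat k1.
by case: ifP => [/andP[/eqP -> _] ->|] //; lia.
Qed.

(** The position of D counted from 1 is the index of U_k counted from 0. *)
Lemma DU_positionsE k p i : (1 <= k)%N ->
  DU_positions k p i <-> nth 0 (DU_word p) i = k%:Z.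
Proof.
move=> k1; have [lt_ip|le_pi] := ltnP i (size p); last first.
  rewrite nth_default ?size_pairmap //; split=> [[/andP[_]]|]; lia.
rewrite (nth_pairmap 0) // (DU_stepP _ _ k1) /DU_positions /= lt_ip.
case: i lt_ip => [|i] lt_ip /=; first by split=> [[]|[]].
by split=> [[]|[]].
Qed.

(** Every letter of [DU_word] is -1 or some k >= 1, so the places of the latter determine the
    word. *)
Lemma DU_equivE p q : size p = size q ->
  DU_equiv p q <-> DU_word p = DU_word q.
Proof.
move=> eq_pq; split=> [e|e k k1]; last first.
  by apply/seteqP; split=> i; rewrite !DU_positionsE // e.
have pos i k : (1 <= k)%N -> nth 0 (DU_word p) i = k%:Z <-> nth 0 (DU_word q) i = k%:Z.
  by move=> k1; rewrite -!DU_positionsE // e.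
have val s i : (i < size s)%N ->
    nth 0 (DU_word s) i = -1 \/ exists2 k : nat, (1 <= k)%N & nth 0 (DU_word s) i = k%:Z.
  move=> lt_is; rewrite (nth_pairmap 0) // /DU_step.
  case: ifP => [/andP[_ j1]|_]; last by left.
  by right; exists (absz (nth 0 s i)); lia.
apply: (@eq_from_nth _ 0) => [|i]; rewrite !size_pairmap // => lt_ip.
case: (val p i lt_ip) => [ep|[k k1 ep]]; last by rewrite ep; symmetry; apply/pos.
case: (val q i _) => [|->|[k k1 eq]] //; first by rewrite -eq_pq.
by rewrite eq; apply/pos.
Qed.

Lemma pairmap_tails n (q : seq int) i : q \in tails n -> pairmap DU_step i q = q.
Proof.
move=> qT; move: n q qT i; apply: tails_ind => //= [n q _ IH i|n q k _ IH kq i].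
  by rewrite IH /DU_step lerNr andbF.
rewrite IH /DU_step eqxx /= andbF; congr [:: _, _ & _].
by rewrite lez_nat; case/andP: kq => ->.
Qed.

(** The bound on the total carries the induction: a kept letter k satisfies [k + total t <= 0],
    hence is at most the depth of the word made from [t]. *)
Lemma pairmap_in_tails (i : int) (t : seq int) :
  i != -1 -> {in t, forall j : int, -1 <= j} ->
  (forall m, total (drop m t) <= 0) ->
  pairmap DU_step i t \in tails (size t) /\
  total (pairmap DU_step i t) <= total t.
Proof.
have [m le_tm] := ubnP (size t).
elim: m i t le_tm => // m IH i [|j t] le_tm i1 t1 dt; first by [].
have j1 : -1 <= j by apply: t1; rewrite mem_head.
have {i i1}-> : pairmap DU_step i (j :: t) = -1 :: pairmap DU_step j t.
  by rewrite /= {1}/DU_step (negbTE i1).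
case: t le_tm t1 dt => [_ _ _|k t le_tm t1 dt].
  by rewrite !total_cons total_nil inE; split=> //; lia.
have k1 : -1 <= k by apply: t1; rewrite !inE eqxx orbT.
have {}t1 : {in k :: t, forall j : int, -1 <= j}.
  by move=> l lt; apply: t1; rewrite inE lt orbT.
have [/andP[/eqP ej k0]|jk] := boolP ((j == -1) && (1 <= k)).
  have -> : pairmap DU_step j (k :: t) = k :: pairmap DU_step k t.
    by rewrite /= {1}/DU_step ej k0.
  have [||||qT le_q] := IH k t; try by [].
  - exact: ltnW.
  - by lia.
  - by move=> l lt; apply: t1; rewrite inE lt orbT.
  - by move=> l; have := dt l.+2.
  split; last by rewrite !total_cons; lia.
  have := dt 1%N; rewrite /= total_cons => dt1.
  have sq := sum_tails qT.
  rewrite /= mem_cat; apply/orP; right; apply/allpairsPdep.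
  exists (pairmap DU_step k t), (depth (pairmap DU_step k t) - absz k)%N.
  split=> //; first by rewrite mem_iota; lia.
  by congr [:: _, _ & _]; lia.
(* Here [j] may be -1, but [k] is lowered anyway, so 0 can replace [j] and the induction hypothesis
   applies. *)
have -> : pairmap DU_step j (k :: t) = pairmap DU_step 0 (k :: t).
  by rewrite /= /DU_step (negbTE jk).
have [||||qT le_q] := IH 0 (k :: t) => //.
  by move=> l; have := dt l.+1.
split; last by rewrite [X in X <= _]total_cons [X in _ <= X]total_cons; lia.
by rewrite [size _]/= tailsSS mem_cat map_f.
Qed.

Lemma DU_word_lukasiewicz n p : lukasiewicz n.+1 p ->
  DU_word p \in [seq -1 :: q | q <- tails n].
Proof.
case: p => [[]//|i t] [[<-] ge sum_ge sum0].
have {}sum0 : total (i :: t) = 0 := sum0.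
have {}sum_ge m : (m <= (size t).+1)%N -> 0 <= total (take m (i :: t)) := sum_ge m.
have i0 : 0 <= i.
  by have := sum_ge 1%N isT; rewrite /= take0 total_cons total_nil addr0.
rewrite /DU_word /= {1}/DU_step /= map_f //.
have [||m|] := @pairmap_in_tails i t => //; first by lia.
  by move=> j jt; apply: ge; rewrite inE jt orbT.
(* As the path has total 0, a suffix sum is minus a prefix sum. *)
have [le_mt|lt_tm] := leqP m (size t); last by rewrite drop_oversize ?total_nil // ltnW.
have := sum_ge m.+1 le_mt; have := sum0.
by rewrite /= !total_cons (total_take_drop m t); lia.
Qed.

Lemma lukasiewicz_tails n (q : seq int) : q \in tails n ->
  lukasiewicz n.+1 ((depth q)%:Z :: q).
Proof.
move=> qT; have sq := sum_tails qT; split=> [|i|m _|].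
- by rewrite /= (size_tails qT).
- by rewrite inE => /orP[/eqP ->|/(tails_ge qT)] //; lia.
- rewrite -/(total _); case: m => [|m]; rewrite /= ?total_nil // total_cons.
  have := sum_drop_tails m qT; move: sq.
  by rewrite (total_take_drop m q); lia.
- by rewrite -/(total _) total_cons sq; lia.
Qed.

(** * Counting the classes *)

(** Classes are the fibres of [DU_word]; these are nonempty over [s], so distinct words give
    distinct classes. *)
Lemma num_DU_classesE n (s : seq (seq int)) : uniq s ->
  (forall p, lukasiewicz n p -> DU_word p \in s) ->
  (forall w, w \in s -> exists2 p, lukasiewicz n p & DU_word p = w) ->
  num_DU_classes n = size s.
Proof.
move=> uniq_s mem_s s_mem.
pose cls w := [set p | lukasiewicz n p /\ DU_word p = w]%classic.
have clsE p : lukasiewicz n p -> DU_class n p = cls (DU_word p).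
  move=> Lp; apply/seteqP; split=> q [Lq]; have [sp _ _ _] := Lp; have [sq _ _ _] := Lq.
    by rewrite DU_equivE ?sp ?sq // => e; split.
  by move=> e; split=> //; rewrite DU_equivE ?sp ?sq.
rewrite /num_DU_classes; have -> : DU_classes n = [set` [seq cls w | w <- s]]%classic.
  apply/seteqP; split=> [_ [p Lp <-]|_ /mapP[w ws ->]] /=.
    by rewrite clsE // map_f // mem_s.
  by have [p Lp <-] := s_mem w ws; exists p => //; rewrite clsE.
rewrite -(size_map cls).
have -> : [set` [seq cls w | w <- s]]%classic =
    [set` [fset c in [seq cls w | w <- s]]%fset]%classic.
  by apply/seteqP; split=> c /=; rewrite inE.
rewrite set_fsetK card_fseq undup_id // map_inj_in_uniq // => w w' ws w's e.
have [p Lp pw] := s_mem w ws.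
have : cls w p by split.
by rewrite e => -[_ <-].
Qed.

Lemma num_DU_classesS n : num_DU_classes n.+1 = size (tails n).
Proof.
rewrite (@num_DU_classesE _ [seq -1 :: q | q <- tails n]) ?size_map //.
- by rewrite map_inj_uniq ?uniq_tails // => q q' [].
- exact: DU_word_lukasiewicz.
move=> _ /mapP[q qT ->]; exists ((depth q)%:Z :: q); first exact: lukasiewicz_tails.
by rewrite /DU_word /= (pairmap_tails _ qT).
Qed.

Lemma num_DU_classes0 : num_DU_classes 0 = 1%N.
Proof.
rewrite (@num_DU_classesE _ [:: [::]]) // => [p [/size0nil -> _ _ _]|w].
  by rewrite inE.
rewrite inE => /eqP ->; exists [::] => //.
by split=> // [m _|]; rewrite ?take_nil big_nil.
Qed.

(** * The generating function *)

Lemma fpsXME (F : fieldType) (f : fps F) n : (fpsX F * f) n.+1 = f n.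
Proof.
rewrite fpsME 2!big_ord_recl big1 /= => [|i _]; last by rewrite mul0r.
by rewrite mul0r mul1r add0r addr0 subn1.
Qed.

Lemma fpsXME0 (F : fieldType) (f : fps F) : (fpsX F * f) 0%N = 0.
Proof. by rewrite fpsME big_ord1 mul0r. Qed.

(** Two roots r, s satisfy (r - s)(r + s) = 0, and r + s is invertible, having constant term 2. *)
Lemma fps_sqrt_uniq (F : fieldType) (f s : fps F) :
  (2 : F) != 0 -> s 0%N = 1 -> s ^+ 2 = f -> fps_sqrt f = s.
Proof.
move=> two0 s0 <-.
have s20 : (s ^+ 2) 0%N = 1 by rewrite expr2 fpsME big_ord1 s0 mul1r.
have := sqr_fps_sqrt two0 s20; set r := fps_sqrt _ => r2.
have u : r + s \is a GRing.unit.
  by rewrite [_ \is a _](_ : _ = ((r + s) 0%N != 0)) // fpsDE s0 fps_sqrt0.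
apply/eqP; rewrite -subr_eq0; apply/eqP; apply: (mulIr u).
by rewrite -subr_sqr r2 subrr mul0r.
Qed.

(** The right side is the discriminant (1 - x + x^2)^2 - 4x^2 of the quadratic in [A]. *)
Lemma quadratic_discriminant (R : comNzRingType) (x A : R) :
  x ^+ 2 * A ^+ 2 = (1 - x + x ^+ 2) * A - 1 ->
  (1 - x + x ^+ 2 * (1 - 2 * A)) ^+ 2 =
    1 - 2 * x - x ^+ 2 - 2 * x ^+ 3 + x ^+ 4.
Proof. by move=> eqA; ring: eqA. Qed.

Lemma quadratic_fraction (R : comNzRingType) (x A r : R) :
  x ^+ 2 * A ^+ 2 = (1 - x + x ^+ 2) * A - 1 ->
  r = 1 - x + x ^+ 2 * (1 - 2 * A) ->
  (1 + x * A) * (1 - 2 * x - x ^+ 3 + (1 - x) * r) =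
    1 - x - x ^+ 2 - 2 * x ^+ 3 + r.
Proof. by move=> eqA ->; ring: eqA. Qed.

Theorem theorem13 :
  (let x : fps rat := fpsX rat in
   let r : fps rat := fps_sqrt (1 - 2 * x - x ^+ 2 - 2 * x ^+ 3 + x ^+ 4) in
   Fps (fun n => (num_DU_classes n)%:R) =
     (1 - x - x ^+ 2 - 2 * x ^+ 3 + r)
       / (1 - 2 * x - x ^+ 3 + (1 - x) * r))
  /\ [/\ num_DU_classes 0 = 1%N, num_DU_classes 1 = 1%N
       & num_DU_classes 2 = 1%N]
  /\ (forall a : nat -> nat,
        a 0%N = 1%N ->
        (forall m : nat,
           a m.+1 = (a m + \sum_(1 <= k < m) a k * a (m - 1 - k))%N) ->
        forall n : nat, (3 <= n)%N -> num_DU_classes n = a (n - 1)%N).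
Proof.
split; last first.
  split; first by rewrite num_DU_classes0 !num_DU_classesS.
  move=> a a0 aS [//|n] _; rewrite num_DU_classesS subn1 /=.
  have [m le_nm] := ubnP n; elim: m n le_nm => // m IH [|n] le_nm; first by rewrite a0.
  rewrite size_tailsS aS IH //; congr (_ + _)%N.
  by apply: eq_big_nat => k kn; rewrite !IH //; lia.
move=> x r.
pose A : fps rat := Fps (fun n => (size (tails n))%:R).
have UE : Fps (fun n => (num_DU_classes n)%:R) = 1 + x * A.
  apply: fpsP => -[|n]; rewrite fpsDE fps1E ?fpsXME0 ?fpsXME /=.
    by rewrite num_DU_classes0 addr0.
  by rewrite num_DU_classesS add0r.
have AE : A = 1 + x * (A + x * ((A - 1) * A)).
  apply: fpsP => -[|n]; rewrite fpsDE fps1E ?fpsXME0 ?fpsXME ?addr0 //.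
  rewrite add0r fpsDE [LHS]/= size_tailsS natrD; congr (_ + _).
  case: n => [|n]; first by rewrite big_geq // fpsXME0.
  (* The constant term of [A - 1] is 0, matching a sum that starts at k = 1. *)
  rewrite fpsXME fpsME big_ord_recl fpsDE fpsNE fps1E subrr mul0r add0r.
  rewrite big_add1 big_mkord subn1 natr_sum; apply: eq_bigr => i _.
  by rewrite fpsDE fpsNE fps1E subr0 natrM.
have quadA : x ^+ 2 * A ^+ 2 = (1 - x + x ^+ 2) * A - 1.
  move: A x AE {UE r} => A x AE.
  have -> : (1 - x + x ^+ 2) * A - 1 =
      A - (1 + x * (A + x * ((A - 1) * A))) + x ^+ 2 * A ^+ 2 by ring.
  by rewrite -AE subrr add0r.
have rE : r = 1 - x + x ^+ 2 * (1 - 2 * A).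
  apply: fps_sqrt_uniq => //; last exact: quadratic_discriminant.
  by rewrite expr2 -mulrA fpsDE fpsDE fpsNE fpsXME0 fps1E subr0 addr0.
have u : 1 - 2 * x - x ^+ 3 + (1 - x) * r \is a GRing.unit.
  rewrite [_ \is a _](_ : _ = ((1 - 2 * x - x ^+ 3 + (1 - x) * r) 0%N != 0)) //.
  (* Collecting the multiples of [x] shows the constant term 1 + 1 of the denominator. *)
  have -> : 1 - 2 * x - x ^+ 3 + (1 - x) * r = 1 + r - x * (2 + x ^+ 2 + r).
    by move: x r {UE AE quadA rE} => x r; ring.
  by rewrite fpsDE fpsDE fpsNE fpsXME0 fps_sqrt0.
by apply: (mulIr u); rewrite divrK // UE; apply: quadratic_fraction.
Qed.
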